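(* Let $(a,b)$ be a pair of coprime positive integers. Then the anthyphairetic rectangle $R(a,b)$, and hence the sequence of coprime pairs generated by the anthyphairetic process which starts from $(a,b)$, is obtained from the continued fraction expansion of the rational number $b/a$ by the following steps. (S1) Transform the continued fraction expansion of $b/a$ into the lotus $\Lambda(b/a)$. (S2) Decorate both base vertices of the last petal of $\Lambda(b/a)$ by the integer $1$. (S3) Descend the lotus petal by petal, from the last petal to the first one, attaching at each step, for the current petal, the sum of the two integers already decorating two of its vertices to its third, undecorated, vertex. (S4) Once this is finished, construct $R(a,b)$ by stacking (from bottom to top) the base edges of the petals of $\Lambda(b/a)$, endowed with the previous numerical decorations, in the order in which they appear when one starts from the base $[e_1,e_2]$ of $\Lambda(b/a)$.
   Context: **Lotus.** Let $N$ be a free abelian group of rank two with a basis $(e_1,e_2)$, and let $N_{\mathbb{R}} := N\otimes_{\mathbb{Z}}\mathbb{R}$. For a basis $(f_1,f_2)$ of $N$, its petal $\delta(f_1,f_2)$ is the triangle in $N_{\mathbb{R}}$ with vertices $f_1, f_2, f_1+f_2$; its base is the segment $[f_1,f_2]$, its base vertices are $f_1,f_2$, and its summit is $f_1+f_2$. The universal lotus $\Lambda(e_1,e_2)$ is the simplicial complex of pure dimension two in $N_{\mathbb{R}}$ whose triangles are the petals associated to all bases of $N$ whose elements have non-negative coordinates relative to $(e_1,e_2)$. For coprime positive integers $a,b$, the lotus $\Lambda(b/a)$ is the finite subcomplex of $\Lambda(e_1,e_2)$ consisting of those petals whose interiors intersect the segment $[0, a e_1 + b e_2]$, together with their edges and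 vertices; its base is $[e_1,e_2]$. Since the continued fraction expansion of $b/a$ determines $b/a$, it determines $\Lambda(b/a)$. **Order and sides.** The petals of $\Lambda(b/a)$ are ordered as they are met when travelling along the segment from $0$ to $a e_1+b e_2$: the first petal is $\delta(e_1,e_2)$, the base of each later petal is an edge, different from the base, of the preceding petal, and the last petal is the one whose summit is $a e_1+b e_2$. For each petal of $\Lambda(b/a)$, the base vertices are written $(f_1,f_2)$ so that $(f_1,f_2)$ has the same orientation as $(e_1,e_2)$; then $f_2$ is regarded as the left vertex and $f_1$ as the right vertex of the base edge (so $e_2$ is on the left and $e_1$ on the right for the first petal). **Anthyphairetic process.** Starting from a pair $(a,b)$ of coprime positive integers, set $(a_0,b_0)=(a,b)$ and, as long as $(a_i,b_i)\neq(1,1)$, set $(a_{i+1},b_{i+1})=(a_i,b_i-a_i)$ if $a_i<b_i$ and $(a_{i+1},b_{i+1})=(a_i-b_i,b_i)$ if $a_i>b_i$. This ends at $(a_n,b_n)=(1,1)$ for some $n\ge 0$. The sequence of coprime pairs generated is $(a_0,b_0),\dots,(a_n,b_n)$. **Subtraction rectangles.** The subtraction rectangle $S(a,b)$ is a rectangle with two horizontal edges (bottom and top) and two vertical edges (left and right), whose lower left vertex is decorated by $a$ and lower right vertex by $b$. If $a<b$, its upper left vertex is decorated by $a$ and its upper right vertex by $b-a$. If $a>b$, its upper left vertex is decorated by $a-b$ and its upper right vertex by $b$. If $(a,b)=(1,1)$, the two upper vertices are undecorated. **Anthyphairetic rectangle.** $R(a,b)$ is obtained by stacking, from bottom to top,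 the subtraction rectangles $S(a_0,b_0),\dots,S(a_n,b_n)=S(1,1)$, the top edge of $S(a_i,b_i)$ being identified with the bottom edge of $S(a_{i+1},b_{i+1})$ for $0\le i<n$ (left vertex with left vertex, right with right). Thus the bottom edges of the successive rectangles carry the decorations $(a_i,b_i)$ (left, right). Stacking the decorated base edges in (S4) means taking them as the successive bottom edges of the stacked rectangles, the uppermost rectangle having an additional undecorated top edge. *)

(* Defs.v *)
From HB Require Import structures.
From mathcomp Require Import all_boot all_order all_algebra.
From mathcomp Require Import all_classical all_reals all_analysis.

Set Implicit Arguments.
Unset Strict Implicit.
Unset Printing Implicit Defensive.

Import Order.TTheory GRing.Theory Num.Theory.
Import numFieldNormedType.Exports.

Local Open Scope classical_set_scope.
Local Open Scope ring_scope.

Definition subtract_step (p : nat * nat) : nat * nat :=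
  if (p.1 < p.2)%N then (p.1, p.2 - p.1)%N
  else if (p.2 < p.1)%N then (p.1 - p.2, p.2)%N
  else p.

(* [k] only bounds the recursion: while the entries are positive and distinct,
   each step decreases their sum. *)
Fixpoint anthyphairesis_rec (k : nat) (p : nat * nat) : seq (nat * nat) :=
  if p == (1, 1)%N then [:: p]
  else if k is k'.+1 then p :: anthyphairesis_rec k' (subtract_step p)
  else [:: p].

Definition anthyphairesis (a b : nat) : seq (nat * nat) :=
  anthyphairesis_rec (a + b)%N (a, b).

(* The decorations of the left and right vertices of a horizontal edge;
   [None] means undecorated. *)
Definition edge : Type := (option nat * option nat)%type.

Definition decorated_edge (p : nat * nat) : edge := (Some p.1, Some p.2).

Definition undecorated_edge : edge := (None, None).

Record rectangle : Type := Rectangle { bottom : edge; top : edge }.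

Definition subtraction_rectangle (p : nat * nat) : rectangle :=
  Rectangle (decorated_edge p)
    (if p == (1, 1)%N then undecorated_edge
     else decorated_edge (subtract_step p)).

(* A stack of rectangles is listed from bottom to top, the top edge of each
   one being identified with the bottom edge of the next one. *)
Definition anthyphairetic_rectangle (a b : nat) : seq rectangle :=
  [seq subtraction_rectangle p | p <- anthyphairesis a b].

Fixpoint stack_edges (es : seq edge) : seq rectangle :=
  if es is e :: es' then
    Rectangle e (head undecorated_edge es') :: stack_edges es'
  else [::].

(* Euclid's algorithm on [(m, n)]; [k] only bounds the recursion. *)
Fixpoint cf_rec (k m n : nat) : seq nat :=
  if k is k'.+1 then
    if n == 0%N then [::] else (m %/ n)%N :: cf_rec k' n (m %% n)%N
  else [::].

Definition cf_expansion (q : rat) : seq nat :=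
  cf_rec `|denq q|.+1 `|numq q| `|denq q|.

(* The continued fraction [c0; c1, ..., ck] is listed as c0, c1, ..., ck. Its
   innermost term is [ck + 0^-1 = ck], since [0^-1 = 0] in [rat]. *)
Definition cf_value (c : seq nat) : rat :=
  foldr (fun ci x => ci%:R + x^-1) 0 c.

(* The free abelian group N of rank two is ['rV[int]_2], embedded by
   [real_point] below in N_R = ['rV[R]_2]. *)
Definition is_basis (f1 f2 : 'rV[int]_2) : Prop :=
  forall v : 'rV[int]_2, exists! c : int * int, v = c.1 *: f1 + c.2 *: f2.

Definition basis_det (f1 f2 : 'rV[int]_2) : int :=
  \det (col_mx f1 f2 : 'M[int]_2).

Definition same_orientation (f1 f2 e1 e2 : 'rV[int]_2) : Prop :=
  0 < basis_det f1 f2 * basis_det e1 e2.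

Definition nonneg_coords (e1 e2 v : 'rV[int]_2) : Prop :=
  exists m n : nat, v = e1 *+ m + e2 *+ n.

Definition real_point (R : realType) (v : 'rV[int]_2) : 'rV[R]_2 :=
  map_mx intr v.

Definition triangle (R : realType) (x y z : 'rV[R]_2) : set 'rV[R]_2 :=
  [set w | exists r s t : R,
     [/\ 0 <= r, 0 <= s, 0 <= t, r + s + t = 1
       & w = r *: x + s *: y + t *: z]].

(* A petal is given by its pair [(f1, f2)] of base vertices, where [f1] is the
   right one and [f2] the left one. *)
Definition petal : Type := ('rV[int]_2 * 'rV[int]_2)%type.

Definition summit (p : petal) : 'rV[int]_2 := p.1 + p.2.

Definition petal_triangle (R : realType) (p : petal) : set 'rV[R]_2 :=
  triangle (real_point R p.1) (real_point R p.2) (real_point R (summit p)).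

(* Both [(f1, f2)] and [(f2, f1)] define the same triangle: each petal is
   represented once, by the basis oriented as [(e1, e2)]. *)
Definition universal_lotus (e1 e2 : 'rV[int]_2) : set petal :=
  [set p | [/\ is_basis p.1 p.2, nonneg_coords e1 e2 p.1,
               nonneg_coords e1 e2 p.2 & same_orientation p.1 p.2 e1 e2]].

(* The endpoint a e1 + b e2, where q = b / a in lowest terms. *)
Definition lotus_target (e1 e2 : 'rV[int]_2) (q : rat) : 'rV[int]_2 :=
  denq q *: e1 + numq q *: e2.

(* [t] is the parameter, along the segment from 0 to the target, of a point
   of the interior of the petal [p]. *)
Definition meets_interior_at (R : realType) (v : 'rV[int]_2) (p : petal)
    (t : R) : Prop :=
  [/\ 0 <= t, t <= 1 & (petal_triangle p)° (t *: real_point R v)].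

(* The lotus of q as the set of its petals, which determines the subcomplex:
   its other simplices are the edges and vertices of these petals. *)
Definition lotus (R : realType) (e1 e2 : 'rV[int]_2) (q : rat) : set petal :=
  [set p | universal_lotus e1 e2 p /\
           exists t : R, meets_interior_at (lotus_target e1 e2 q) p t].

Definition met_before (R : realType) (v : 'rV[int]_2) (p p' : petal) : Prop :=
  forall t t' : R,
    meets_interior_at v p t -> meets_interior_at v p' t' -> t < t'.

(* [s] lists the petals of the lotus of q in the order in which they are met
   when travelling along the segment from 0. *)
Definition lotus_in_order (R : realType) (e1 e2 : 'rV[int]_2) (q : rat)
    (s : seq petal) : Prop :=
  (forall p : petal, p \in s <-> lotus R e1 e2 q p) /\
  pairwise (fun p p' => `[< met_before R (lotus_target e1 e2 q) p p' >]) s.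

Definition decoration : Type := 'rV[int]_2 -> option nat.

Definition undecorated : decoration := fun _ => None.

Definition decorate (d : decoration) (v : 'rV[int]_2) (m : nat) : decoration :=
  fun w => if w == v then Some m else d w.

Definition decorate_last (s : seq petal) : decoration :=
  if s is p :: s' then
    decorate (decorate undecorated (last p s').1 1) (last p s').2 1
  else undecorated.

(* Fails unless exactly two of the three vertices are decorated. *)
Definition attach_sum (p : petal) (d : decoration) : option decoration :=
  match d p.1, d p.2, d (summit p) with
  | Some m, Some n, None => Some (decorate d (summit p) (m + n)%N)
  | Some m, None, Some n => Some (decorate d p.2 (m + n)%N)
  | None, Some m, Some n => Some (decorate d p.1 (m + n)%N)
  | _, _, _ => None
  end.

(* [foldr] treats the last petal first and the first petal last. *)
Definition descend (s : seq petal) (d : decoration) : option decoration :=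
  foldr (fun p od => obind (attach_sum p) od) (Some d) s.

Definition base_edge (d : decoration) (p : petal) : edge := (d p.2, d p.1).

(* Main.v *)
Require Import Defs.
From mathcomp Require Import all_boot all_order all_algebra.
From mathcomp Require Import all_classical all_reals all_analysis.
From mathcomp Require Import zify ring lra.

Import Order.TTheory GRing.Theory Num.Theory.
Import numFieldNormedType.Exports.

Local Open Scope ring_scope.

(** Write the endpoint of the segment as [v = x f1 + y f2] in the basis given by
    a petal [(f1, f2)]. The point [t v] is interior to the petal iff [t x < 1],
    [t y < 1] and [t (x + y) > 1] ([meets_interiorP]). Hence the petal belongs to
    the lotus iff [x] and [y] are positive ([lotusP]), and the parameters of its
    interior points form the interval from [1 / (x + y)] to [1 / max x y].

    If [x < y], then [v = x (f1 + f2) + (y - x) f2], so the petal [(f1 + f2, f2)]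
    is crossed next, with coordinates [(x, y - x)]; the case [x > y] is symmetric,
    and if [x = y = 1] then [v] is the summit and the petal is the last one. The
    coordinates of [v] in the successive petals thus run through the
    anthyphairetic process. The relation [route] records this joint evolution,
    and each claim is proved by induction on it.

    The petals of the route are all the petals of the lotus: an oriented basis
    with non-negative coordinates in [(f1, f2)] either is [(f1, f2)] or lies
    entirely in one of the two halves of the cone cut by [f1 + f2]
    ([sl2_nat_cases]), and the position of [v] decides which half
    ([route_complete]). They are met in the order of the route, since the
    interval of a petal ends at [1 / max x y], where those of the following petals
    begin at the earliest: their coordinates have a sum at most [max x y]
    ([route_met]).

    Finally, the descent recovers the coordinates: it decorates [f2] by [x] and
    [f1] by [y], that is, each base vertex by the absolute value of its
    determinant with [v]. Indeed, if [x < y], the next petal leaves [x] on [f2]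
    and [y - x] on [f1 + f2], while [f1] is undecorated because it lies outside
    the cone of the later petals; the sum attached to it is [y]
    ([route_descend]). *)

(** * Determinants and bases in rank two *)

Definition det2 {K : comNzRingType} (u w : 'rV[K]_2) : K :=
  u 0 0 * w 0 1 - u 0 1 * w 0 0.

Lemma eq_rV2 {K : Type} (u w : 'rV[K]_2) :
  u 0 0 = w 0 0 -> u 0 1 = w 0 1 -> u = w.
Proof.
move=> h0 h1; apply/rowP; case=> [[|[|//]] hi].
- by rewrite (_ : Ordinal hi = 0) //; apply: val_inj.
- by rewrite (_ : Ordinal hi = 1) //; apply: val_inj.
Qed.

Lemma det_mx2E {K : comNzRingType} (A : 'M[K]_2) :
  \det A = A 0 0 * A 1 1 - A 0 1 * A 1 0.
Proof.
rewrite (expand_det_row _ 0) !big_ord_recl big_ord0 addr0.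
rewrite /cofactor !det_mx11 !mxE /=.
have -> : lift ord0 ord0 = 1 :> 'I_2 by apply: val_inj.
have -> : lift 1 0 = 0 :> 'I_2 by apply: val_inj.
by rewrite /bump /= expr0 expr1 mul1r mulN1r mulrN.
Qed.

Lemma basis_detE (f1 f2 : 'rV[int]_2) : basis_det f1 f2 = det2 f1 f2.
Proof.
have up j : (col_mx f1 f2 : 'M[int]_2) 0 j = f1 0 j.
  by rewrite -(col_mxEu f1 f2 0 j); congr (fun_of_matrix _ _ j); apply: val_inj.
have dn j : (col_mx f1 f2 : 'M[int]_2) 1 j = f2 0 j.
  by rewrite -(col_mxEd f1 f2 0 j); congr (fun_of_matrix _ _ j); apply: val_inj.
by rewrite /basis_det det_mx2E !up !dn.
Qed.

Lemma det2_comb {K : comNzRingType} (f g : 'rV[K]_2) (k l m n : K) :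
  det2 (k *: f + l *: g) (m *: f + n *: g) = (k * n - l * m) * det2 f g.
Proof. rewrite /det2 !mxE; ring. Qed.

Lemma cramer2 {K : comNzRingType} (f g w : 'rV[K]_2) :
  det2 f g *: w = det2 w g *: f + det2 f w *: g.
Proof. by apply: eq_rV2; rewrite /det2 !mxE; ring. Qed.

Lemma det2_combl {K : comNzRingType} (f g : 'rV[K]_2) (k l : K) :
  det2 (k *: f + l *: g) g = k * det2 f g.
Proof. rewrite /det2 !mxE; ring. Qed.

Lemma det2_combr {K : comNzRingType} (f g : 'rV[K]_2) (k l : K) :
  det2 f (k *: f + l *: g) = l * det2 f g.
Proof. rewrite /det2 !mxE; ring. Qed.

Lemma det2_free {K : idomainType} (f g : 'rV[K]_2) (k l m n : K) :
  det2 f g != 0 -> k *: f + l *: g = m *: f + n *: g -> k = m /\ l = n.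
Proof.
move=> D0 e; split; apply: (mulIf D0).
- by rewrite -(det2_combl f g k l) e det2_combl.
- by rewrite -(det2_combr f g k l) e det2_combr.
Qed.

(** Applying the multiplicativity of [det2] to the coordinates of the canonical
    basis shows that the determinant of a basis is invertible; the converse is
    Cramer's rule. *)
Lemma is_basisP (f1 f2 : 'rV[int]_2) :
  is_basis f1 f2 <-> det2 f1 f2 \is a GRing.unit.
Proof.
split=> [hb | hu v].
- pose E (i : 'I_2) : 'rV[int]_2 := \row_j (j == i)%:R.
  have [[a b] [/= e0 _]] := hb (E 0).
  have [[c d] [/= e1 _]] := hb (E 1).
  have := det2_comb f1 f2 a b c d; rewrite -e0 -e1 {1}/det2 !mxE /=.
  rewrite mulr1 mulr0 subr0 => h; apply/unitrPr; exists (a * d - b * c).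
  by rewrite mulrC -h.
- exists (det2 v f2 / det2 f1 f2, det2 f1 v / det2 f1 f2); split=> /=.
    rewrite -[LHS]scale1r -(mulVr hu) -scalerA (cramer2 f1 f2 v) scalerDr !scalerA.
    by rewrite (mulrC (det2 v f2)) (mulrC (det2 f1 v)).
  case=> k l /= e.
  have [<- <- //] : k = det2 v f2 / det2 f1 f2 /\ l = det2 f1 v / det2 f1 f2.
  by rewrite e det2_combl det2_combr !mulrK.
Qed.

Lemma is_basis_det2_neq0 (f1 f2 : 'rV[int]_2) :
  is_basis f1 f2 -> det2 f1 f2 != 0.
Proof. by move=> /is_basisP; apply: contraTneq => ->; rewrite unitr0. Qed.

(** * Coordinates in a petal *)

Definition comb (p : petal) (c : nat * nat) : 'rV[int]_2 :=
  p.1 *+ c.1 + p.2 *+ c.2.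

Definition petal_det (p : petal) : int := det2 p.1 p.2.

Lemma combE p c : comb p c = c.1%:Z *: p.1 + c.2%:Z *: p.2.
Proof. by rewrite /comb -!scaler_nat !natz. Qed.

Lemma comb_inj p c c' : petal_det p != 0 -> comb p c = comb p c' -> c = c'.
Proof.
move=> D0; rewrite !combE => /(det2_free _ _ _ _ _ _ D0).
by case: c c' => [a b] [a' b'] /= [] [->] [->].
Qed.

Lemma petal_det_left p : petal_det (summit p, p.2) = petal_det p.
Proof. by rewrite /petal_det /det2 /= !mxE; ring. Qed.

Lemma petal_det_right p : petal_det (p.1, summit p) = petal_det p.
Proof. by rewrite /petal_det /det2 /= !mxE; ring. Qed.

Lemma comb_left p a b : comb (summit p, p.2) (a, b) = comb p (a, a + b)%N.
Proof. by rewrite /comb /= mulrnDl mulrnDr addrA. Qed.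

Lemma comb_right p a b : comb (p.1, summit p) (a, b) = comb p (a + b, b)%N.
Proof. by rewrite /comb /= mulrnDl mulrnDr addrA. Qed.

Lemma comb_fst p : p.1 = comb p (1, 0)%N.
Proof. by rewrite /comb mulr1n mulr0n addr0. Qed.

Lemma comb_snd p : p.2 = comb p (0, 1)%N.
Proof. by rewrite /comb mulr1n mulr0n add0r. Qed.

Lemma comb_summit p : summit p = comb p (1, 1)%N.
Proof. by rewrite /comb !mulr1n. Qed.

Lemma comb_comb p q c1 c2 c : q.1 = comb p c1 -> q.2 = comb p c2 ->
  comb q c = comb p (c.1 * c1.1 + c.2 * c2.1, c.1 * c1.2 + c.2 * c2.2)%N.
Proof.
move=> h1 h2; rewrite {1}/comb h1 h2 /comb /=.
rewrite !mulrnDl -!mulrnA !mulrnDr ![(_ * c.1)%N]mulnC ![(_ * c.2)%N]mulnC.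
by rewrite addrACA.
Qed.

Definition in_cone (p : petal) (w : 'rV[int]_2) : Prop :=
  nonneg_coords p.1 p.2 w.

Lemma in_coneP p w : in_cone p w <-> exists c, w = comb p c.
Proof.
split=> [[m [n h]]|[[m n] h]]; first by exists (m, n).
by exists m, n.
Qed.

Lemma in_cone_fst p : in_cone p p.1.
Proof. by apply/in_coneP; exists (1, 0)%N; exact: comb_fst. Qed.

Lemma in_cone_snd p : in_cone p p.2.
Proof. by apply/in_coneP; exists (0, 1)%N; exact: comb_snd. Qed.

Lemma in_cone_summit p : in_cone p (summit p).
Proof. by apply/in_coneP; exists (1, 1)%N; exact: comb_summit. Qed.

Lemma in_cone_trans p q w :
  in_cone p q.1 -> in_cone p q.2 -> in_cone q w -> in_cone p w.
Proof.
move=> /in_coneP [c1 h1] /in_coneP [c2 h2] /in_coneP [c ->].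
by apply/in_coneP; eexists; exact: comb_comb h1 h2.
Qed.

Lemma petal_det_comb p q c1 c2 : q.1 = comb p c1 -> q.2 = comb p c2 ->
  petal_det p != 0 -> petal_det q = petal_det p ->
  (c1.1 * c2.2 = c1.2 * c2.1 + 1)%N.
Proof.
move=> h1 h2 D0; rewrite {1}/petal_det h1 h2 !combE det2_comb.
rewrite -/(petal_det p) -[RHS]mul1r => /(mulIf D0); lia.
Qed.

(** * Routes *)

(** [route p c s cs]: a ray whose endpoint has coordinates [c] in the petal [p]
    crosses, from [p] on, the petals [s], in which its endpoint has the
    coordinates [cs]. The coordinates [c] are written as sums so that the
    constructors need no subtraction. *)
Inductive route : petal -> nat * nat -> seq petal -> seq (nat * nat) -> Prop :=
| route_last p : route p (1, 1)%N [:: p] [:: (1, 1)%N]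
| route_left p a b s cs : (0 < a)%N -> (0 < b)%N ->
    route (summit p, p.2) (a, b) s cs ->
    route p (a, a + b)%N (p :: s) ((a, a + b)%N :: cs)
| route_right p a b s cs : (0 < a)%N -> (0 < b)%N ->
    route (p.1, summit p) (a, b) s cs ->
    route p (a + b, b)%N (p :: s) ((a + b, b)%N :: cs).

Lemma subtract_step_left a b : (0 < b)%N ->
  subtract_step (a, a + b)%N = (a, b).
Proof.
by move=> b0; rewrite /subtract_step /= -{1}[a]addn0 ltn_add2l b0 addKn.
Qed.

Lemma subtract_step_right a b : (0 < a)%N ->
  subtract_step (a + b, b)%N = (a, b).
Proof.
move=> a0; rewrite /subtract_step /= ltnNge leq_addl /=.
by rewrite -{1}[b]add0n ltn_add2r a0 addnK.
Qed.

Lemma route_exists k p a b : (0 < a)%N -> (0 < b)%N -> coprime a b ->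
  (a + b <= k)%N -> exists s, route p (a, b) s (anthyphairesis_rec k (a, b)).
Proof.
elim: k p a b => [|k IH] p a b a0 b0 cab hk; first lia.
rewrite [anthyphairesis_rec _ _]/=; case: eqP => [[-> ->]|ne].
  by exists [:: p]; exact: route_last.
case: (ltngtP a b) => [lt|lt|e].
- have eb : b = (a + (b - a))%N by rewrite subnKC // ltnW.
  have d0 : (0 < b - a)%N by rewrite subn_gt0.
  have cd : coprime a (b - a) by move: cab; rewrite {1}eb /coprime gcdnDl.
  have [|s hs] := IH (summit p, p.2) a (b - a)%N a0 d0 cd; first lia.
  exists (p :: s); rewrite eb subtract_step_left //.
  exact: route_left.
- have ea : a = ((a - b) + b)%N by rewrite subnK // ltnW.
  have d0 : (0 < a - b)%N by rewrite subn_gt0.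
  have cd : coprime (a - b) b.
    by move: cab; rewrite {1}ea /coprime gcdnC gcdnDr gcdnC.
  have [|s hs] := IH (p.1, summit p) (a - b)%N b d0 b0 cd; first lia.
  exists (p :: s); rewrite ea subtract_step_right //.
  exact: route_right.
- by move: cab ne; rewrite -e /coprime gcdnn => /eqP ->.
Qed.

(** Decorated bottom edges suffice to reconstruct the rectangles, because the top
    edge of a subtraction rectangle carries the next pair of the process. *)
Lemma route_stack p c s cs : route p c s cs ->
  head undecorated_edge (map decorated_edge cs) = decorated_edge c /\
  stack_edges (map decorated_edge cs) = map subtraction_rectangle cs.
Proof.
elim=> {p c s cs} [p|p a b s cs a0 b0 _ [hd IH]|p a b s cs a0 b0 _ [hd IH]] //.
- split=> //=; rewrite IH hd /subtraction_rectangle subtract_step_left //.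
  by case: eqP => // -[]; lia.
- split=> //=; rewrite IH hd /subtraction_rectangle subtract_step_right //.
  by case: eqP => // -[]; lia.
Qed.

(** Coordinates only decrease along a route, which bounds from below the
    parameters at which its petals are met. *)
Lemma route_sound p c s cs : route p c s cs -> forall q, q \in s ->
  [/\ petal_det q = petal_det p, in_cone p q.1, in_cone p q.2 &
      exists c', [/\ (0 < c'.1)%N, (0 < c'.2)%N,
                     (c'.1 + c'.2 <= c.1 + c.2)%N & comb q c' = comb p c]].
Proof.
have self p' c0 : (0 < c0.1)%N -> (0 < c0.2)%N ->
  [/\ petal_det p' = petal_det p', in_cone p' p'.1, in_cone p' p'.2 &
      exists c', [/\ (0 < c'.1)%N, (0 < c'.2)%N,
                     (c'.1 + c'.2 <= c0.1 + c0.2)%N & comb p' c' = comb p' c0]].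
  move=> h1 h2; split; [by []|exact: in_cone_fst|exact: in_cone_snd|].
  by exists c0.
elim=> {p c s cs} [p|p a b s cs a0 b0 _ IH|p a b s cs a0 b0 _ IH] q.
- by rewrite inE => /eqP ->; exact: self.
- rewrite inE => /orP [/eqP ->|/IH]; first by apply: self => //=; lia.
  rewrite petal_det_left comb_left => -[-> h1 h2 [c' [? ? hc ?]]].
  have sub :=
    in_cone_trans p (summit p, p.2) _ (in_cone_summit p) (in_cone_snd p).
  split; [by []|exact: sub|exact: sub|].
  by exists c'; split=> //=; move: hc => /=; lia.
- rewrite inE => /orP [/eqP ->|/IH]; first by apply: self => //=; lia.
  rewrite petal_det_right comb_right => -[-> h1 h2 [c' [? ? hc ?]]].
  have sub :=
    in_cone_trans p (p.1, summit p) _ (in_cone_fst p) (in_cone_summit p).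
  split; [by []|exact: sub|exact: sub|].
  by exists c'; split=> //=; move: hc => /=; lia.
Qed.

(** Read [(k, l)] and [(m, n)] as the coordinates of an oriented basis inside a
    cone: unless it is the basis of the cone itself, its vectors lie on the same
    side of the diagonal. Indeed [k < l] and [n < m] would make the determinant
    negative, while [k > l] and [n > m] give [k n >= (l + 1) (m + 1)], which
    leaves only [l = m = 0]. *)
Lemma sl2_nat_cases (k l m n : nat) : (k * n = l * m + 1)%N ->
  [\/ [/\ k = 1, l = 0, m = 0 & n = 1]%N, (k <= l /\ m <= n)%N
    | (l <= k /\ n <= m)%N].
Proof.
move=> h; case: (leqP k l) => kl; case: (leqP m n) => mn.
- by apply: Or32.
- by nia.
- case: (leqP n m) => nm; first by apply: Or33; lia.
  by apply: Or31; split; nia.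
- by apply: Or33; lia.
Qed.

(** A positive combination of a basis whose vectors are on or above the diagonal
    lies strictly above it, as they cannot both be on it. *)
Lemma sl2_nat_lt (k l m n x y : nat) : (0 < x)%N -> (0 < y)%N ->
  (k * n = l * m + 1)%N -> (k <= l)%N -> (m <= n)%N ->
  (x * k + y * m < x * l + y * n)%N.
Proof.
move=> x0 y0 h kl mn; rewrite -addnS leq_add ?leq_mul2l ?kl ?orbT //.
rewrite ltn_pmul2l // ltn_neqAle mn andbT; apply/eqP => e.
by move: h; rewrite e => h; have := leq_mul kl (leqnn n); lia.
Qed.

(** A sub-petal whose open cone contains the endpoint is either the current petal
    or contained in one of the two halves of its cone. In the second case the
    endpoint lies strictly inside that half, so the route enters it. *)
Lemma route_complete p c s cs : route p c s cs -> petal_det p != 0 ->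
  forall q c', petal_det q = petal_det p -> in_cone p q.1 -> in_cone p q.2 ->
  (0 < c'.1)%N -> (0 < c'.2)%N -> comb q c' = comb p c -> q \in s.
Proof.
move=> + + q [x y] + + + /= x0 y0.
elim=> {p c s cs} [p|p a b s cs a0 b0 _ IH|p a b s cs a0 b0 _ IH] D0 Dq
  /in_coneP [[k l] h1] /in_coneP [[m n] h2];
  have det1 := petal_det_comb _ _ _ _ h1 h2 D0 Dq;
  rewrite (comb_comb _ _ _ _ _ h1 h2) => /(comb_inj _ _ _ D0) /= [ea eb];
  have [[/= ek el em en]|[kl mn]|[lk nm]] := sl2_nat_cases _ _ _ _ det1.
1,4,7: by rewrite inE (_ : q == p) //; apply/eqP; rewrite [q]surjective_pairing
   h1 h2 ek el em en -comb_fst -comb_snd -surjective_pairing.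
- by have := sl2_nat_lt _ _ _ _ _ _ x0 y0 det1 kl mn; rewrite /= ea eb; lia.
- have det1' : (n * k = m * l + 1)%N by rewrite mulnC det1 mulnC.
  have := sl2_nat_lt _ _ _ _ _ _ y0 x0 det1' nm lk.
  by rewrite /= addnC [X in (_ < X)%N]addnC ea eb; lia.
- rewrite inE IH ?orbT ?petal_det_left //.
  + apply/in_coneP; exists (k, l - k)%N.
    by rewrite comb_left subnKC.
  + apply/in_coneP; exists (m, n - m)%N.
    by rewrite comb_left subnKC.
  + rewrite comb_left (comb_comb _ _ _ _ _ h1 h2) /=.
    by congr (comb p (_, _)).
- have det1' : (n * k = m * l + 1)%N by rewrite mulnC det1 mulnC.
  have := sl2_nat_lt _ _ _ _ _ _ y0 x0 det1' nm lk.
  by rewrite /= addnC [X in (_ < X)%N]addnC ea eb; lia.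
- by have := sl2_nat_lt _ _ _ _ _ _ x0 y0 det1 kl mn; rewrite /= ea eb; lia.
- rewrite inE IH ?orbT ?petal_det_right //.
  + apply/in_coneP; exists (k - l, l)%N.
    by rewrite comb_right subnK.
  + apply/in_coneP; exists (m - n, n)%N.
    by rewrite comb_right subnK.
  + rewrite comb_right (comb_comb _ _ _ _ _ h1 h2) /=.
    by congr (comb p (_, _)).
Qed.

(** * The decorations *)

Lemma decorate_same d v m : decorate d v m v = Some m.
Proof. by rewrite /decorate eqxx. Qed.

Lemma decorate_other d v m w : w <> v -> decorate d v m w = d w.
Proof. by rewrite /decorate; case: eqP. Qed.

(** The hypotheses make every base vertex of [s] decorated, hence distinct from
    [v]. *)
Lemma base_edge_decorate d v m (s : seq petal) (cs : seq (nat * nat)) :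
  d v = None ->
  map decorated_edge cs = map (base_edge d) s ->
  map decorated_edge cs = map (base_edge (decorate d v m)) s.
Proof.
move=> dv; elim: s cs => [|q s IH] [|c cs] //= [h1 h2 h].
rewrite -(IH cs h); congr (_ :: _).
rewrite /base_edge !decorate_other -?h1 -?h2 // => e.
- by move: dv; rewrite -e -h2.
- by move: dv; rewrite -e -h1.
Qed.

(** Decorations stay in the cone of the first petal of the route. Hence, when the
    descent goes on to the preceding petal, the base vertex of the latter that is
    not in this cone is still undecorated. *)
Lemma route_descend p c s cs : route p c s cs -> petal_det p != 0 ->
  exists d, [/\ descend s (decorate_last s) = Some d,
    d p.2 = Some c.1, d p.1 = Some c.2,
    forall w, d w <> None -> in_cone p w &
    map decorated_edge cs = map (base_edge d) s].
Proof.
elim=> {p c s cs} [p|p a b s cs a0 b0 r IH|p a b s cs a0 b0 r IH] D0;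
  have n12 : p.1 <> p.2 by
    rewrite comb_fst [X in _ <> X]comb_snd => /(comb_inj _ _ _ D0).
- have ns1 : summit p <> p.1.
    by rewrite comb_summit comb_fst => /(comb_inj _ _ _ D0).
  have ns2 : summit p <> p.2.
    by rewrite comb_summit comb_snd => /(comb_inj _ _ _ D0).
  set d0 := decorate (decorate undecorated p.1 1) p.2 1.
  have d1 : d0 p.1 = Some 1%N by rewrite /d0 decorate_other // decorate_same.
  have d2 : d0 p.2 = Some 1%N by rewrite /d0 decorate_same.
  have ds : d0 (summit p) = None by rewrite /d0 !decorate_other.
  exists (decorate d0 (summit p) 2); split.
  + by rewrite /= -/d0 /attach_sum d1 d2 ds.
  + by rewrite decorate_other //; exact: nesym.
  + by rewrite decorate_other //; exact: nesym.
  + move=> w; rewrite /d0 /decorate; case: eqP => [-> _|_].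
      exact: in_cone_summit.
    case: eqP => [-> _|_]; first exact: in_cone_snd.
    by case: eqP => [-> _|//]; exact: in_cone_fst.
  + by rewrite /= /base_edge !decorate_other ?d1 ?d2 //; exact: nesym.
- have [|d [hd /= hd2 hds hcone hs]] := IH; first by rewrite petal_det_left.
  have d1 : d p.1 = None.
    case e : (d p.1) => [m|//].
    have /in_coneP [[k l]] : in_cone (summit p, p.2) p.1.
      by apply: hcone; rewrite e.
    by rewrite comb_left {1}comb_fst => /(comb_inj _ _ _ D0) [<-].
  exists (decorate d p.1 (a + b)%N); split.
  + have dl : decorate_last (p :: s) = decorate_last s by case: r.
    by rewrite -/(decorate_last (p :: s)) dl hd /= /attach_sum d1 hd2 hds.
  + by rewrite decorate_other //; exact: nesym.
  + by rewrite decorate_same.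
  + move=> w; rewrite /decorate; case: eqP => [-> _|_ /hcone].
      exact: in_cone_fst.
    by apply: in_cone_trans; [exact: in_cone_summit|exact: in_cone_snd].
  + rewrite /= -(base_edge_decorate _ _ _ _ _ _ hs) //; congr (_ :: _).
    by rewrite /base_edge decorate_same decorate_other ?hd2 //; exact: nesym.
- have [|d [hd /= hds hd1 hcone hs]] := IH; first by rewrite petal_det_right.
  have d2 : d p.2 = None.
    case e : (d p.2) => [m|//].
    have /in_coneP [[k l]] : in_cone (p.1, summit p) p.2.
      by apply: hcone; rewrite e.
    by rewrite comb_right {1}comb_snd => /(comb_inj _ _ _ D0) []; lia.
  exists (decorate d p.2 (a + b)%N); split.
  + have dl : decorate_last (p :: s) = decorate_last s by case: r.
    by rewrite -/(decorate_last (p :: s)) dl hd /= /attach_sum hd1 d2 hds addnC.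
  + by rewrite decorate_same.
  + by rewrite decorate_other.
  + move=> w; rewrite /decorate; case: eqP => [-> _|_ /hcone].
      exact: in_cone_snd.
    by apply: in_cone_trans; [exact: in_cone_fst|exact: in_cone_summit].
  + rewrite /= -(base_edge_decorate _ _ _ _ _ _ hs) //; congr (_ :: _).
    by rewrite /base_edge decorate_same decorate_other ?hd1.
Qed.

(** * The interior of a petal *)

Lemma interior_shift (R : realType) (S : set 'rV[R]_2) (w u : 'rV[R]_2) :
  interior S w -> exists2 e : R, 0 < e & S (w + e *: u).
Proof.
move=> Sw.
have cont : ((fun e : R => w + e *: u) @ (0 : R) --> w)%classic.
  rewrite -[X in (_ --> X)%classic]addr0 -[X in _ + X](scale0r u).
  by apply: cvgD; [exact: cvg_cst|apply: cvgZr_tmp; exact: cvg_id].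
have /nbhs_ballP [e /= e0 he] := cont _ Sw.
exists (e / 2); first by rewrite divr_gt0.
apply: he; rewrite -ball_normE /= sub0r normrN gtr0_norm ?divr_gt0 //.
by rewrite ltr_pdivrMr // ltr_pMr // ltr1n.
Qed.

Lemma triangleP (R : realType) (f g : 'rV[R]_2) (x y : R) : det2 f g != 0 ->
  triangle f g (f + g) (x *: f + y *: g) <-> [/\ x <= 1, y <= 1 & 1 <= x + y].
Proof.
move=> D0; split=> [[r [s [t [r0 s0 t0 rst e]]]]|[x1 y1 xy]].
- have [-> ->] : x = r + t /\ y = s + t.
    apply: (det2_free f g) => //; rewrite e scalerDr !scalerDl.
    by rewrite addrACA !addrA.
  by split; lra.
- exists (1 - y), (1 - x), (x + y - 1); split; [lra|lra|lra|ring|].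
  by apply: eq_rV2; rewrite !mxE; ring.
Qed.

Lemma continuous_det2l (R : realType) (g : 'rV[R]_2) :
  continuous (fun w : 'rV[R]_2 => det2 w g).
Proof.
move=> w; apply: (@cvgB R R _ (nbhs w)); apply: (@cvgMr_tmp R _ (nbhs w));
  exact: coord_continuous.
Qed.

Lemma continuous_det2r (R : realType) (f : 'rV[R]_2) :
  continuous (fun w : 'rV[R]_2 => det2 f w).
Proof.
move=> w; apply: (@cvgB R R _ (nbhs w)); apply: (@cvgMl_tmp R _ (nbhs w));
  exact: coord_continuous.
Qed.

(** An interior point can be moved a little along [f], [g] and [- f] without
    leaving the triangle, so none of the three inequalities of [triangleP] is an
    equality there. Conversely, the strict inequalities define an open set, as
    coordinates are continuous by Cramer's rule. *)
Lemma interior_triangleP (R : realType) (f g : 'rV[R]_2) (x y : R) :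
  det2 f g != 0 ->
  interior (triangle f g (f + g)) (x *: f + y *: g) <->
  [/\ x < 1, y < 1 & 1 < x + y].
Proof.
move=> D0; split=> [hi|[x1 y1 xy]].
- have [d1 d10] := interior_shift _ _ _ f hi.
  rewrite addrAC -scalerDl => /(triangleP _ _ _ _ _ D0) [h1 _ _].
  have [d2 d20] := interior_shift _ _ _ g hi.
  rewrite -addrA -scalerDl => /(triangleP _ _ _ _ _ D0) [_ h2 _].
  have [d3 d30] := interior_shift _ _ _ (- f) hi.
  rewrite scalerN addrAC -scalerBl => /(triangleP _ _ _ _ _ D0) [_ _ h3].
  by split; lra.
- pose X (w : 'rV[R]_2) := det2 w g / det2 f g.
  pose Y (w : 'rV[R]_2) := det2 f w / det2 f g.
  have XE : X (x *: f + y *: g) = x by rewrite /X det2_combl mulfK.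
  have YE : Y (x *: f + y *: g) = y by rewrite /Y det2_combr mulfK.
  have wE w : w = X w *: f + Y w *: g.
    apply: (scalerI D0); rewrite (cramer2 f g w) scalerDr !scalerA.
    by rewrite ![det2 f g * _]mulrC !divfK.
  have cX : {for x *: f + y *: g, continuous X}.
    by apply: (@cvgMr_tmp R _ (nbhs _)); exact: continuous_det2l.
  have cY : {for x *: f + y *: g, continuous Y}.
    by apply: (@cvgMr_tmp R _ (nbhs _)); exact: continuous_det2r.
  have nX : \forall w \near nbhs (x *: f + y *: g), X w < 1.
    by apply: (cvgr_lt _ cX); rewrite XE.
  have nY : \forall w \near nbhs (x *: f + y *: g), Y w < 1.
    by apply: (cvgr_lt _ cY); rewrite YE.
  have nXY : \forall w \near nbhs (x *: f + y *: g), 1 < X w + Y w.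
    by apply: (cvgr_gt _ (cvgD cX cY)); rewrite XE YE.
  change (nbhs (x *: f + y *: g) (triangle f g (f + g))).
  apply: filterS3 nX nY nXY => w hX hY hXY.
  by rewrite (wE w); apply/triangleP => //; split; rewrite ltW.
Qed.

(** * The petals of the lotus *)

Lemma real_pointD (R : realType) (f g : 'rV[int]_2) :
  real_point R (f + g) = real_point R f + real_point R g.
Proof. exact: raddfD. Qed.

Lemma real_pointZ (R : realType) (k : int) (f : 'rV[int]_2) :
  real_point R (k *: f) = k%:~R *: real_point R f.
Proof. exact: map_mxZ. Qed.

Lemma det2_real_point (R : realType) (f g : 'rV[int]_2) :
  det2 (real_point R f) (real_point R g) = (det2 f g)%:~R.
Proof. by rewrite /det2 !mxE rmorphB !rmorphM. Qed.

Lemma meets_interiorP (R : realType) (p : petal) (k l : int) (t : R) :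
  petal_det p != 0 ->
  meets_interior_at (k *: p.1 + l *: p.2) p t <->
  [/\ 0 <= t <= 1, t * k%:~R < 1, t * l%:~R < 1 & 1 < t * k%:~R + t * l%:~R].
Proof.
move=> D0.
have DR : det2 (real_point R p.1) (real_point R p.2) != 0.
  by rewrite det2_real_point intr_eq0.
rewrite /meets_interior_at /petal_triangle /summit !real_pointD !real_pointZ.
rewrite scalerDr !scalerA.
split=> [[t0 t1 /(interior_triangleP _ _ _ _ _ DR) [h1 h2 h3]]|
         [/andP [t0 t1] h1 h2 h3]].
- by rewrite t0 t1.
- by split=> //; apply/interior_triangleP.
Qed.

Lemma meets_combP (R : realType) (p : petal) c (t : R) :
  petal_det p != 0 ->
  meets_interior_at (comb p c) p t <->
  [/\ 0 <= t <= 1, t * c.1%:R < 1, t * c.2%:R < 1 & 1 < t * (c.1 + c.2)%:R].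
Proof.
by move=> D0; rewrite combE natrD mulrDr; exact: meets_interiorP.
Qed.

Lemma meets_comb_exists (R : realType) (p : petal) c :
  petal_det p != 0 -> (0 < c.1)%N -> (0 < c.2)%N ->
  exists t : R, meets_interior_at (comb p c) p t.
Proof.
move=> D0 x0 y0; pose n := (c.1 + c.2 + maxn c.1 c.2)%N.
have n0 : 0 < n%:R :> R by rewrite ltr0n /n; lia.
(* The harmonic mean of [1 / (c.1 + c.2)] and [1 / maxn c.1 c.2], the ends of
   the interval of parameters. *)
exists (2 / n%:R); apply/(meets_combP _ _ _ _ D0).
split.
- apply/andP; split; first by rewrite divr_ge0.
  by rewrite ler_pdivrMr // mul1r ler_nat; lia.
- by rewrite mulrAC ltr_pdivrMr // mul1r -natrM ltr_nat; lia.
- by rewrite mulrAC ltr_pdivrMr // mul1r -natrM ltr_nat; lia.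
- by rewrite mulrAC ltr_pdivlMr // mul1r -natrM ltr_nat; lia.
Qed.

Lemma int_unit_eq (x y : int) : x \is a GRing.unit -> y \is a GRing.unit ->
  0 < x * y -> x = y.
Proof. by move=> /orP [] /eqP -> /orP [] /eqP ->. Qed.

Lemma universal_lotusP (e1 e2 : 'rV[int]_2) (p : petal) : is_basis e1 e2 ->
  universal_lotus e1 e2 p <->
  [/\ petal_det p = det2 e1 e2, in_cone (e1, e2) p.1 & in_cone (e1, e2) p.2].
Proof.
move=> /is_basisP ue; rewrite /universal_lotus /= /same_orientation !basis_detE.
split=> [[/is_basisP up c1 c2 o]|[D c1 c2]].
- by split=> //; exact: int_unit_eq.
- split=> //; first by apply/is_basisP; rewrite -/(petal_det p) D.
  by rewrite -/(petal_det p) D; move: ue => /orP [] /eqP ->.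
Qed.

Lemma lotusP (R : realType) (e1 e2 : 'rV[int]_2) (q : rat) (p : petal) :
  is_basis e1 e2 ->
  lotus R e1 e2 q p <->
  [/\ petal_det p = det2 e1 e2, in_cone (e1, e2) p.1, in_cone (e1, e2) p.2 &
      exists c, [/\ (0 < c.1)%N, (0 < c.2)%N & comb p c = lotus_target e1 e2 q]].
Proof.
move=> he; have D0 := is_basis_det2_neq0 _ _ he.
rewrite /lotus /=; split.
- move=> [hu [t ht]]; have /(universal_lotusP _ _ _ he) [D c1 c2] := hu.
  split=> //; have [/(_ (lotus_target e1 e2 q)) [[k l] [/= e _]] _ _ _] := hu.
  move: ht; rewrite e => /meets_interiorP; rewrite D => /(_ D0).
  move=> [/andP [t0 t1] h1 h2 h3].
  have k0 : 0 < k.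
    rewrite ltNge; apply/negP => k0.
    have : t * k%:~R <= 0 by rewrite mulr_ge0_le0 // lerz0.
    lra.
  have l0 : 0 < l.
    rewrite ltNge; apply/negP => l0.
    have : t * l%:~R <= 0 by rewrite mulr_ge0_le0 // lerz0.
    lra.
  exists (`|k|%N, `|l|%N).
  by rewrite combE /= !gez0_abs ?ltW //; split=> //; lia.
- move=> [D c1 c2 [c [x0 y0 <-]]]; split; first exact/universal_lotusP.
  by apply: meets_comb_exists; rewrite ?D.
Qed.

Lemma route_late (R : realType) p c s cs (t : R) q : route p c s cs ->
  petal_det p != 0 -> q \in s -> meets_interior_at (comb p c) q t ->
  1 < t * (c.1 + c.2)%:R.
Proof.
move=> r D0 /(route_sound _ _ _ _ r) [D _ _ [c0 [_ _ le <-]]].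
move=> /meets_combP; rewrite D => /(_ D0) [/andP [t0 _] _ _ h].
by apply: (lt_le_trans h); rewrite ler_wpM2l // ler_nat.
Qed.

(** The separating parameter is [1 / (a + b)]: in a step from [(a, a + b)] or
    [(a + b, b)] to [(a, b)], the larger old coordinate is the sum of the new
    ones. *)
Lemma route_met (R : realType) p c s cs : route p c s cs -> petal_det p != 0 ->
  pairwise (fun q q' => `[< met_before R (comb p c) q q' >]) s.
Proof.
elim=> {p c s cs} [p|p a b s cs a0 b0 r IH|p a b s cs a0 b0 r IH] D0 //;
  have n0 : 0 < (a + b)%:R :> R by rewrite ltr0n; lia.
- rewrite /= -comb_left IH ?petal_det_left // andbT.
  apply/allP => q hq; apply/asboolP => t t'.
  rewrite {1}comb_left => /(meets_combP _ _ _ _ D0) [_ _ /= h _].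
  move=> /(route_late _ _ _ _ _ _ _ r); rewrite petal_det_left => /(_ D0 hq) /=.
  by move=> h'; rewrite -(ltr_pM2r n0) (lt_trans h).
- rewrite /= -comb_right IH ?petal_det_right // andbT.
  apply/allP => q hq; apply/asboolP => t t'.
  rewrite {1}comb_right => /(meets_combP _ _ _ _ D0) [_ /= h _ _].
  move=> /(route_late _ _ _ _ _ _ _ r); rewrite petal_det_right => /(_ D0 hq) /=.
  by move=> h'; rewrite -(ltr_pM2r n0) (lt_trans h).
Qed.

Lemma route_in_order (R : realType) (e1 e2 : 'rV[int]_2) (q : rat) c s cs :
  is_basis e1 e2 -> lotus_target e1 e2 q = comb (e1, e2) c ->
  route (e1, e2) c s cs -> lotus_in_order R e1 e2 q s.
Proof.
move=> he ev r.
have D0 : petal_det (e1, e2) != 0 := is_basis_det2_neq0 _ _ he.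
split; last by rewrite ev; exact: route_met r D0.
move=> p; rewrite (lotusP _ _ _ _ _ he) ev; split.
- move=> /(route_sound _ _ _ _ r) [D c1 c2 [c' [x0 y0 _ e]]].
  by split=> //; exists c'.
- by move=> [D c1 c2 [c' [x0 y0 e]]]; apply: (route_complete _ _ _ _ r D0 p c').
Qed.

(** Every petal of the lotus is met at some parameter, so on these petals
    [met_before] is a strict order, and a strictly sorted list is determined by
    its set of entries. *)
Lemma lotus_in_order_unique (R : realType) (e1 e2 : 'rV[int]_2) (q : rat) s s' :
  lotus_in_order R e1 e2 q s -> lotus_in_order R e1 e2 q s' -> s = s'.
Proof.
move=> [m1 o1] [m2 o2].
have met p : p \in s ->
    exists t : R, meets_interior_at (lotus_target e1 e2 q) p t.
  by move=> /m1 [].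
apply: irr_sorted_eq_in (pairwise_sorted o1) (pairwise_sorted o2) _.
- move=> y x z /met [ty hy] _ _ /asboolP xy /asboolP yz.
  apply/asboolP => t t' h h'.
  exact: lt_trans (xy _ _ h hy) (yz _ _ hy h').
- move=> x /met [t ht]; apply/asboolP => /(_ t t ht ht).
  by rewrite ltxx.
- by move=> p; apply/idP/idP => [/m1/m2|/m2/m1].
Qed.

(** * Continued fractions *)

(** In [rat] the inverse of [0] is [0], so the formula also holds for [n = 0],
    where the expansion is empty. *)
Lemma cf_value_rec k m n : (n < k)%N -> cf_value (cf_rec k m n) = m%:R / n%:R.
Proof.
elim: k m n => [//|k IH] m n hk /=; case: eqP => [->|/eqP n0].
  by rewrite invr0 mulr0.
have nz : n%:R != 0 :> rat by rewrite pnatr_eq0.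
rewrite /= -/(cf_value _) IH; last first.
  by apply: leq_trans (ltn_pmod _ _) _; rewrite ?lt0n // -ltnS.
by rewrite invf_div [in RHS](divn_eq m n) natrD natrM mulrDl mulfK.
Qed.

Lemma cf_value_expansion (q : rat) : 0 <= q -> cf_value (cf_expansion q) = q.
Proof.
move=> q0; rewrite /cf_expansion cf_value_rec //.
rewrite !natr_absz !ger0_norm ?numq_ge0 ?denq_ge0 //; exact: divq_num_den.
Qed.

Lemma lotus_target_frac (e1 e2 : 'rV[int]_2) a b : (0 < a)%N -> coprime a b ->
  lotus_target e1 e2 (b%:R / a%:R) = comb (e1, e2) (a, b).
Proof.
move=> a0 cab; rewrite combE /lotus_target /=.
have -> : b%:R / a%:R = (b%:Z)%:~R / (a%:Z)%:~R :> rat by [].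
have c : coprime `|b%:Z| `|a%:Z| by rewrite coprime_sym.
rewrite coprimeq_num // coprimeq_den // gtr0_sg // mul1r.
by rewrite gt_eqF.
Qed.

(** * The anthyphairetic rectangle from the lotus *)

Theorem proposition6p1 (R : realType) (e1 e2 : 'rV[int]_2) (a b : nat)
    (he : is_basis e1 e2) (ha : (0 < a)%N) (hb : (0 < b)%N)
    (hab : coprime a b) :
  let c : seq nat := cf_expansion (b%:R / a%:R) in
  exists (s : seq petal) (d : decoration),
    [/\ (* S1: the petals of the lotus, in order *)
        lotus_in_order R e1 e2 (cf_value c) s,
        forall s' : seq petal,
          lotus_in_order R e1 e2 (cf_value c) s' -> s' = s,
        (* S2, S3 *)
        descend s (decorate_last s) = Some d,
        (* S4 *)
        anthyphairetic_rectangle a b = stack_edges [seq base_edge d p | p <- s]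
      & [seq decorated_edge p | p <- anthyphairesis a b] =
        [seq base_edge d p | p <- s]].
Proof.
move=> c; rewrite /c cf_value_expansion ?divr_ge0 ?ler0n //.
have D0 : petal_det (e1, e2) != 0 := is_basis_det2_neq0 _ _ he.
have [s r] := route_exists _ (e1, e2) a b ha hb hab (leqnn _).
have target := lotus_target_frac e1 e2 _ _ ha hab.
have ord := route_in_order R e1 e2 _ _ _ _ he target r.
have [d [hd _ _ _ hs]] := route_descend _ _ _ _ r D0.
exists s, d; split=> //.
- by move=> s' ord'; exact: lotus_in_order_unique ord' ord.
- by rewrite -hs /anthyphairetic_rectangle -(route_stack _ _ _ _ r).2.
Qed.
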